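(* Let $M=M[U,L]$ be a connected lattice path matroid of rank $r$ on $r+m$ elements and let $k$ be a positive integer. Then $L^k_M=kQ_M\cap\mathbb{Z}^{r+m-1}$.
   Context: A lattice path from $(0,0)$ to $(m,r)$ uses unit steps $(1,0)$, $(0,1)$; its step vector lists the $y$-changes of the steps. For lattice paths $U,L$ from $(0,0)$ to $(m,r)$ with $L$ never above $U$, $M[U,L]$ is the matroid on $\{1,\dots,r+m\}$ whose bases are the index sets of $(0,1)$-steps of lattice paths never above $U$ and never below $L$; it is connected iff $U$ and $L$ meet only at $(0,0)$ and $(m,r)$. Write $\mathrm{st}(L)=(L_1,\dots,L_{r+m})$, $\mathrm{st}(U)=(U_1,\dots,U_{r+m})$. $Q_M$ is the polytope of all $q\in\mathbb{R}^{r+m-1}$ with $0\le(-1)^{L_{i+1}}(q_{i+1}-q_i)\le1$ for $i=1,\dots,r+m-2$ and $0\le q_i\le\sum_{j=1}^i(U_j-L_j)$ for $i=1,\dots,r+m-1$. Let $R(M)$ be the closed region bounded by $U$ and $L$. The poset $X^k_M$ has as elements the points $(x,y)\in R(M)$ with $x+y\in\mathbb{Z}$, $ky\in\mathbb{Z}$, and $(x,y)$ not lying on the path $L$; its order is the reflexive–transitive closure of the relations $(x,y)<(x-\tfrac1k,y+\tfrac1k)$ (consecutive points on the same line $x+y=\text{const}$), $(x+1,y)<(x,y)$ and $(x,y)<(x,y+1)$, imposed whenever both points involved belong to $X^k_M$. For $i=1,\dots,r+m-1$ let $C_i=\{(x,y)\in X^k_M: x+y=i\}$; these are chains partitioning $X^k_M$.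 For an order ideal $I$ of $X^k_M$ (a set closed under going down) let $\phi(I)\in\mathbb{Z}^{r+m-1}$ be given by $\phi(I)_i=|I\cap C_i|$. Then $L^k_M=\{\phi(I): I \text{ an order ideal of } X^k_M\}$. *)

(* Defs.v *)
From HB Require Import structures.
From Stdlib Require Import Relation_Operators.
From mathcomp Require Import all_boot all_order all_algebra.
From mathcomp Require Import finmap.
From mathcomp Require Import all_classical all_reals.

Set Implicit Arguments.
Unset Strict Implicit.
Unset Printing Implicit Defensive.

Import Order.TTheory GRing.Theory Num.Theory.

Local Open Scope classical_set_scope.
Local Open Scope ring_scope.

(* A lattice path is given by its step vector: [true] is the step (0,1),
   [false] the step (1,0).  Positions are counted from 0, so that
   [nth false s j] is the (j+1)-st entry of the step vector. *)

Definition lattice_path (m r : nat) (s : seq bool) : bool :=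
  (count negb s == m) && (count id s == r).

Definition height (s : seq bool) (i : nat) : nat := count id (take i s).

Definition never_above (n : nat) (P Q : n.-tuple bool) : bool :=
  [forall i : 'I_n.+1, (height P i <= height Q i)%N].

(* Matroids on a subset [S] of a finite type, given by their bases. *)

Definition is_matroid (E : finType) (S : {set E}) (B : {set {set E}}) : Prop :=
  [/\ B != finset.set0,
      forall A, A \in B -> A \subset S
    & forall A A', A \in B -> A' \in B ->
      forall x, x \in A :\: A' ->
      exists2 y, y \in A' :\: A & (y |: (A :\ x))%SET \in B].

Definition direct_sum (E : finType) (B1 B2 : {set {set E}}) : {set {set E}} :=
  [set (A1 :|: A2)%SET | A1 in B1, A2 in B2]%SET.

Definition matroid_connected (E : finType) (S : {set E}) (B : {set {set E}}) :
    Prop :=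
  ~ exists (S1 S2 : {set E}) (B1 B2 : {set {set E}}),
      [/\ S1 != finset.set0, S2 != finset.set0,
          (S1 :&: S2)%SET = finset.set0 & (S1 :|: S2)%SET = S] /\
      [/\ is_matroid S1 B1, is_matroid S2 B2 & B = direct_sum B1 B2].

(* The bases of M[U,L]; the element j+1 of {1,...,r+m} is [j : 'I_(r + m)]. *)
Definition lpm_bases (m r : nat) (U L : (r + m).-tuple bool) :
    {set {set 'I_(r + m)}} :=
  [set [set j | tnth P j]%SET | P : (r + m).-tuple bool
     & [&& lattice_path m r P, never_above P U & never_above L P]]%SET.

Definition lpm_connected (m r : nat) (U L : (r + m).-tuple bool) : Prop :=
  matroid_connected [set: 'I_(r + m)]%SET (lpm_bases U L).

(* The coordinate q_(i+1) is [q 0 i]. *)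
Definition lpm_polytope (R : realType) (m r : nat) (U L : (r + m).-tuple bool) :
    set 'rV[R]_(r + m).-1 :=
  [set q |
    (forall i j : 'I_(r + m).-1, j = i.+1 :> nat ->
       0 <= (-1) ^+ nth false L j * (q 0 j - q 0 i) <= 1) /\
    (forall i : 'I_(r + m).-1,
       0 <= q 0 i <=
         \sum_(0 <= j < i.+1) ((nth false U j)%:R - (nth false L j)%:R))].

Definition dilation (R : realType) (n k : nat) (Q : set 'rV[R]_n) :
    set 'rV[R]_n :=
  [set k%:R *: q | q in Q].

Definition integer_points (R : realType) (n : nat) : set 'rV[R]_n :=
  [set v | forall i, v 0 i \is a Num.int].

Definition vertex (R : realType) (s : seq bool) (i : nat) : R * R :=
  ((count negb (take i s))%:R, (count id (take i s))%:R).

(* The path as a subset of the plane.  For [size s <= i] the segment is the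
   end point of the path. *)
Definition path_points (R : realType) (s : seq bool) : set (R * R) :=
  [set p | exists (i : nat) (t : R), 0 <= t <= 1 /\
     p = ((1 - t) * (vertex R s i).1 + t * (vertex R s i.+1).1,
          (1 - t) * (vertex R s i).2 + t * (vertex R s i.+1).2)].

Definition lpm_region (R : realType) (U L : seq bool) : set (R * R) :=
  [set p | exists y1 y2 : R,
     [/\ y1 <= p.2 <= y2, path_points L (p.1, y1) & path_points U (p.1, y2)]].

Definition lpm_poset (R : realType) (k : nat) (U L : seq bool) : set (R * R) :=
  [set p | [/\ lpm_region U L p, p.1 + p.2 \is a Num.int,
               k%:R * p.2 \is a Num.int & ~ path_points L p]].

Inductive lpm_basic_rel (R : realType) (k : nat) : R * R -> R * R -> Prop :=
| Diagonal x y : lpm_basic_rel k (x, y) (x - k%:R^-1, y + k%:R^-1)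
| Horizontal x y : lpm_basic_rel k (x + 1, y) (x, y)
| Vertical x y : lpm_basic_rel k (x, y) (x, y + 1).

Definition lpm_le (R : realType) (k : nat) (U L : seq bool) :
    R * R -> R * R -> Prop :=
  clos_refl_trans (R * R) (fun p q =>
    [/\ lpm_poset k U L p, lpm_poset k U L q & lpm_basic_rel k p q]).

Definition order_ideal (R : realType) (k : nat) (U L : seq bool)
    (I : set (R * R)) : Prop :=
  I `<=` lpm_poset k U L /\
  (forall p q, lpm_poset k U L p -> I q -> lpm_le k U L p q -> I p).

Definition lpm_chain (R : realType) (k : nat) (U L : seq bool) (i : nat) :
    set (R * R) :=
  [set p | lpm_poset k U L p /\ p.1 + p.2 = i%:R].

(* [fset_set] sends an infinite set to the empty finite set; each
   [lpm_chain k U L i] with [0 < k] is finite. *)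
Definition ideal_vector (R : realType) (k m r : nat)
    (U L : (r + m).-tuple bool) (I : set (R * R)) : 'rV[R]_(r + m).-1 :=
  \row_i (#|` fset_set (I `&` lpm_chain k U L i.+1)|)%fset%:R.

Definition ideal_vectors (R : realType) (k m r : nat)
    (U L : (r + m).-tuple bool) : set 'rV[R]_(r + m).-1 :=
  [set ideal_vector k U L I | I in [set I | order_ideal k U L I]].

Arguments lpm_polytope R {m r} U L.
Arguments integer_points R n : clear implicits.
Arguments ideal_vectors R k {m r} U L.

(* Main.v *)
(* In the coordinates [c = x + y] and [b = k * y], the elements of the poset on
   the line [x + y = c] are the integers [b] in the interval
   ]k * height L c, k * height U c], and the generating relations read
   (c, b) < (c, b + 1), (c + 1, b) < (c, b) and (c, b) < (c + 1, b + k).  An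
   order ideal is therefore the set of points below a function [t] with
   [k * height L c <= t c <= k * height U c] and [t c <= t c.+1 <= t c + k].
   Since [v_c = t c - k * height L c], these two conditions are the two families
   of inequalities defining [k Q_M], the sign [(-1) ^ L_(c+1)] recording whether
   [height L] stays constant or increases at [c]. *)
Require Import Defs.
From Stdlib Require Import Relation_Operators.
From mathcomp Require Import all_boot all_order all_algebra.
From mathcomp Require Import finmap zify lra ring.
From mathcomp Require Import all_classical all_reals.

Import Order.TTheory GRing.Theory Num.Theory.

Local Open Scope classical_set_scope.
Local Open Scope ring_scope.

(** * Geometry of a single lattice path *)

Section PathGeometry.
Variables (R : realType) (s : seq bool).

Local Notation vx i := (vertex R s i).1.
Local Notation vy i := (vertex R s i).2.

Lemma heightS (i : nat) : height s i.+1 = (height s i + nth false s i)%N.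
Proof.
rewrite /height; case: (ltnP i (size s)) => hi.
  by rewrite (take_nth false hi) -cats1 count_cat /= addn0.
by rewrite (nth_default _ hi) !take_oversize ?addn0 // ltnW.
Qed.

Lemma height_sum (i : nat) :
  (height s i)%:R = \sum_(0 <= j < i) (nth false s j)%:R :> R.
Proof.
elim: i => [|i IH]; first by rewrite big_geq // /height take0.
by rewrite heightS natrD IH big_nat_recr.
Qed.

Lemma vertex_le (i j : nat) : (i <= j)%N -> vx i <= vx j /\ vy i <= vy j.
Proof.
move=> hij; rewrite !ler_nat -(take_takel s hij).
by split; apply/leq_count_subseq/take_subseq.
Qed.

Lemma vertexE (i : nat) : (i <= size s)%N ->
  vertex R s i = (i%:R - (height s i)%:R, (height s i)%:R).
Proof.
move=> hi; congr pair; apply/eqP; rewrite eq_sym subr_eq -natrD eqr_nat.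
by rewrite -{1}(size_takel hi) addnC -(count_predC id).
Qed.

Lemma vertex_path (i : nat) : path_points s (vertex R s i).
Proof.
exists i, 0; rewrite lexx ler01 subr0 !mul1r !mul0r !addr0.
by rewrite -surjective_pairing.
Qed.

(** Points on different segments are separated by a vertex lying between them; on a common segment
    the parameters decide. *)
Lemma path_points_comparable (p q : R * R) :
  path_points s p -> path_points s q ->
  (p.1 <= q.1 /\ p.2 <= q.2) \/ (q.1 <= p.1 /\ q.2 <= p.2).
Proof.
move=> [i [t [/andP[t0 t1] ->]]] [j [u [/andP[u0 u1] ->]]] /=.
have [ix iy] := vertex_le _ _ (leqnSn i); have [jx jy] := vertex_le _ _ (leqnSn j).
move: ix iy jx jy; case: (ltngtP i j) => [lij|lji|->].
- have [hx hy] := vertex_le _ _ lij; rewrite /vertex /= in hx hy *.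
  by move=> *; left; split; nra.
- have [hx hy] := vertex_le _ _ lji; rewrite /vertex /= in hx hy *.
  by move=> *; right; split; nra.
- rewrite /vertex /= => hx hy _ _.
  by case: (lerP t u) => htu; [left|right]; split; nra.
Qed.

Lemma path_points_mono (p q : R * R) :
  path_points s p -> path_points s q -> p.1 + p.2 <= q.1 + q.2 ->
  p.1 <= q.1 /\ p.2 <= q.2.
Proof.
move=> hp hq; case: (path_points_comparable _ _ hp hq) => [[]|[]] *; split; lra.
Qed.

(** A discrete intermediate value argument. The bounds on [y] tell on which side of a given vertex
    the path crosses the vertical line, which is what membership in [lpm_region] requires. *)
Lemma path_points_at (i j : nat) (x : R) : (i <= j)%N -> vx i <= x <= vx j ->
  exists y, path_points s (x, y) /\ vy i <= y <= vy j.
Proof.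
have at_vertex a : vx a <= x <= vx a -> path_points s (x, vy a).
  move=> ha; rewrite -(le_anti ha).
  by rewrite -surjective_pairing; apply: vertex_path.
elim: j => [|j IH] hij /andP[hix hxj].
  move: hij hix; rewrite leqn0 => /eqP -> hx; exists (vy 0%N); rewrite lexx.
  by split=> //; apply: at_vertex; rewrite hx.
move: hij; rewrite leq_eqVlt ltnS => /predU1P[eij|hij].
  rewrite eij in hix *; exists (vy j.+1); rewrite lexx.
  by split=> //; apply: at_vertex; rewrite hix.
have [jx jy] := vertex_le _ _ (leqnSn j); have [ix iy] := vertex_le _ _ hij.
case: (lerP x (vx j)) => hxj'.
  have [|y [hy /andP[h1 h2]]] := IH hij; first by rewrite hix.
  by exists y; split=> //; rewrite h1 (le_trans h2 jy).
(* Segment [j] now has positive width, so [x] determines the parameter [t] on it. *)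
have hd : 0 < vx j.+1 - vx j by lra.
set t := (x - vx j) / (vx j.+1 - vx j).
have t01 : 0 <= t <= 1.
  by rewrite /t ler_pdivrMr // mul1r lerD2r hxj divr_ge0 // subr_ge0 // ltW.
have tE : x - vx j = t * (vx j.+1 - vx j) by rewrite /t divfK // gt_eqF.
clearbody t.
exists ((1 - t) * vy j + t * vy j.+1); split.
  by exists j, t; split=> //; congr pair; rewrite -[LHS](subrK (vx j)) tE; ring.
by move: t01 => /andP[t0 t1]; apply/andP; split; nra.
Qed.

(** Each step raises [x + y] by 1, so vertex [c] lies on this line; by [path_points_mono] it is the
    only point of the path there. *)
Lemma path_points_line (c : nat) (p : R * R) : (c <= size s)%N ->
  p.1 + p.2 = c%:R -> path_points s p <-> p.2 = (height s c)%:R.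
Proof.
move=> hc hp; have hv := vertex_path c; split=> [hps|h2].
  rewrite (vertexE _ hc) in hv.
  have [] := path_points_mono _ _ hps hv; first by rewrite /=; lra.
  have [] := path_points_mono _ _ hv hps; first by rewrite /=; lra.
  by rewrite /=; lra.
suff <- : vertex R s c = p by [].
by rewrite (vertexE _ hc) [p]surjective_pairing; congr pair; lra.
Qed.

End PathGeometry.

(** Induction on [u]: if [P u.+1] holds, [P] holds on the whole interval; otherwise the threshold
    found for [u] still works. The value [t = l] encodes that [P] holds nowhere on it. *)
Lemma down_closed_interval (P : nat -> Prop) (l u : nat) : (l <= u)%N ->
  (forall b, (l < b)%N -> P b.+1 -> P b) ->
  exists2 t, (l <= t <= u)%N & forall b, (l < b <= u)%N -> P b <-> (b <= t)%N.
Proof.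
move=> + hP; elim: u => [|u IH].
  by rewrite leqn0 => /eqP ->; exists 0%N => // b hb; exfalso; lia.
rewrite leq_eqVlt ltnS => /predU1P[->|hlu].
  by exists u.+1 => [|b hb]; [lia|exfalso; lia].
have [t ht tP] := IH hlu.
have [Pu|nPu] := pselect (P u.+1).
  exists u.+1; first lia.
  move=> b /andP[hlb hbu]; rewrite hbu; split=> // _.
  have down d : P (b + d)%N -> P b.
    elim: d => [|d IHd]; first by rewrite addn0.
    by rewrite addnS => /hP h; apply/IHd/h; lia.
  by apply: (down (u.+1 - b)%N); rewrite subnKC.
exists t; first lia.
move=> b /andP[hlb]; rewrite leq_eqVlt ltnS => /predU1P[->|hbu].
  by split=> // h; exfalso; lia.
by apply: tP; rewrite hlb.
Qed.

Lemma heightS_bounds (k : nat) (s : seq bool) (c : nat) :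
  (k * height s c <= k * height s c.+1 <= k * height s c + k)%N.
Proof. by rewrite heightS; case: nth; lia. Qed.

(** * The poset and its order ideals in grid coordinates *)

Section GridPoset.
Variables (R : realType) (k n : nat) (U L : seq bool).
Hypotheses (k_gt0 : (0 < k)%N) (sizeU : size U = n) (sizeL : size L = n).
Hypothesis same_end : height L n = height U n.
Hypothesis LU : forall i, (i <= n)%N -> (height L i <= height U i)%N.

Let kR_gt0 : 0 < k%:R :> R. Proof. by rewrite ltr0n. Qed.

(* The coordinate [b] is [k * y]: in the coordinates [(x + y, k * y)] the
   generating relations of the poset become translations. *)
Definition grid_point (c b : nat) : R * R :=
  (c%:R - b%:R / k%:R, b%:R / k%:R).

Lemma grid_point_sum (c b : nat) :
  (grid_point c b).1 + (grid_point c b).2 = c%:R.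
Proof. by rewrite /= subrK. Qed.

Lemma grid_point_inj (c b c' b' : nat) :
  grid_point c b = grid_point c' b' -> c = c' /\ b = b'.
Proof.
move=> e; have := congr1 (fun p => p.1 + p.2) e.
rewrite !grid_point_sum => /eqP; rewrite eqr_nat => /eqP ->; split=> //.
have /(mulIf _) := congr1 snd e; rewrite invr_eq0 gt_eqF // => /(_ isT) /eqP.
by rewrite eqr_nat => /eqP.
Qed.

(** The region is cut out along vertical lines, the chains along antidiagonals. Forwards,
    monotonicity of the paths compares the abscissa of [p] with those of the vertices [c] of [L] and
    [U]. Backwards, [L] crosses the vertical line through [p] no later than its vertex [c], and [U]
    no earlier than its own; the common end point ensures that [U] does reach it. *)
Lemma lpm_region_line (c : nat) (p : R * R) : (c <= n)%N ->
  p.1 + p.2 = c%:R ->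
  lpm_region U L p <-> (height L c)%:R <= p.2 <= (height U c)%:R.
Proof.
move=> cn hp.
have [cU cL] : (c <= size U)%N /\ (c <= size L)%N by rewrite sizeU sizeL.
have UE := vertexE R _ _ cU; have LE := vertexE R _ _ cL.
split=> [[y1 [y2 [/andP[h1 h2] hL hU]]]|/andP[h1 h2]].
  have := path_points_mono _ _ _ _ hL (vertex_path R L c).
  have := path_points_mono _ _ _ _ (vertex_path R U c) hU.
  rewrite UE LE /= => hU' hL'.
  by have [|? ?] := hU'; [lra | have [|? ?] := hL'; [lra|apply/andP; split; lra]].
have p0 : (vertex R L 0).1 <= p.1 <= (vertex R L c).1.
  rewrite LE /vertex take0 /=.
  have [+ _] := vertex_le R U _ _ (leq0n c); rewrite UE /vertex take0 /=.
  by move=> *; apply/andP; split; lra.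
have pn : (vertex R U c).1 <= p.1 <= (vertex R U n).1.
  rewrite UE (vertexE R U n) ?sizeU // -same_end.
  have [+ _] := vertex_le R L _ _ cn; rewrite LE (vertexE R L n) ?sizeL //=.
  by move=> *; apply/andP; split; lra.
have [y1 [hL /andP[_ hy1]]] := path_points_at _ _ _ _ _ (leq0n c) p0.
have [y2 [hU /andP[hy2 _]]] := path_points_at _ _ _ _ _ cn pn.
exists y1, y2; split=> //; move: hy1 hy2; rewrite LE UE /= => *.
by apply/andP; split; lra.
Qed.

Lemma lpm_region_sum (p : R * R) :
  lpm_region U L p -> 0 <= p.1 + p.2 <= n%:R.
Proof.
move=> [y1 [y2 [/andP[h1 h2] hL hU]]].
(* The [minn] accounts for indices past the end, where [vertex] stays at the end point. *)
have hsum s (i : nat) : (vertex R s i).1 + (vertex R s i).2 = (minn i (size s))%:R.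
  by rewrite -natrD addnC count_predC size_take_min.
have vb s (q : R * R) : path_points s q -> 0 <= q.1 + q.2 <= (size s)%:R.
  move=> [i [t [/andP[t0 t1] ->]]] /=.
  have -> : (1 - t) * (vertex R s i).1 + t * (vertex R s i.+1).1 +
      ((1 - t) * (vertex R s i).2 + t * (vertex R s i.+1).2) =
    (1 - t) * (minn i (size s))%:R + t * (minn i.+1 (size s))%:R.
    by rewrite -!hsum; ring.
  rewrite addr_ge0 ?mulr_ge0 ?subr_ge0 ?ler0n //=.
  have e : (size s)%:R = (1 - t) * (size s)%:R + t * (size s)%:R :> R by ring.
  rewrite [leRHS]e.
  by rewrite lerD // ler_wpM2l ?subr_ge0 // ler_nat geq_minr.
have := vb _ _ hL; have := vb _ _ hU; rewrite sizeU sizeL /=.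
by move=> /andP[? ?] /andP[? ?]; apply/andP; split; lra.
Qed.

Lemma grid_point_poset (c b : nat) : (c <= n)%N ->
  lpm_poset k U L (grid_point c b) <->
  (k * height L c < b <= k * height U c)%N.
Proof.
move=> cn; have ps := grid_point_sum c b.
have cL : (c <= size L)%N by rewrite sizeL.
have kE : k%:R * (grid_point c b).2 = b%:R by rewrite mulrC divfK // gt_eqF.
have hb (h : nat) : ((h%:R <= (grid_point c b).2) = (k * h <= b)%N) *
                    (((grid_point c b).2 <= h%:R) = (b <= k * h)%N).
  by split; rewrite -(ler_pM2l kR_gt0) kE -natrM ler_nat.
have reg := lpm_region_line _ _ cn ps; have onL := path_points_line _ _ _ _ cL ps.
split=> [[/reg/andP[]]|/andP[h1 h2]].
  rewrite !hb => h1 h2 _ _ hne; rewrite h2 andbT ltn_neqAle h1 andbT.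
  apply: contra_notN hne => /eqP e; apply/onL/(mulfI (lt0r_neq0 kR_gt0)).
  by rewrite kE -natrM e.
split; rewrite ?ps ?kE ?natr_int //; first by apply/reg; rewrite !hb h2 ltnW.
by move=> /onL e; move: h1; rewrite ltnNge -(hb _).2 e lexx.
Qed.

(** Take [c = x + y], bounded by [lpm_region_sum], and [b = k * y], a natural number because [y] is
    at least [height L c]. *)
Lemma lpm_posetE (p : R * R) : lpm_poset k U L p ->
  exists c b, (c <= n)%N /\ p = grid_point c b.
Proof.
move=> [hr hsum hk _]; have /andP[s0 sn] := lpm_region_sum _ hr.
have /natrP[c cE] : p.1 + p.2 \is a Num.nat by rewrite natrEint hsum.
have cn : (c <= n)%N by rewrite -(ler_nat R) -cE.
have /andP[hy _] := (lpm_region_line _ _ cn cE).1 hr.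
have /natrP[b bE] : k%:R * p.2 \is a Num.nat.
  by rewrite natrEint hk mulr_ge0 // (le_trans _ hy).
exists c, b; split=> //; rewrite /grid_point -bE -cE mulrAC mulfV ?gt_eqF //.
by rewrite mul1r addrK -surjective_pairing.
Qed.

Lemma lpm_basic_rel_grid (c b c' b' : nat) :
  lpm_basic_rel k (grid_point c b) (grid_point c' b') <->
  [\/ c' = c /\ b' = b.+1, c = c'.+1 /\ b' = b | c' = c.+1 /\ b' = (b + k)%N].
Proof.
have kV : k%:R / k%:R = 1 :> R by rewrite divff // gt_eqF.
split=> [|[[-> ->]|[-> ->]|[-> ->]]].
- move: {-1}(grid_point c b) (erefl (grid_point c b)) => p pE.
  move: {-1}(grid_point c' b') (erefl (grid_point c' b')) => q qE h.
  case: h pE qE => x y pE qE.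
  + apply: Or31; apply: grid_point_inj; rewrite qE.
    by move: pE => [<- <-]; rewrite /grid_point -natr1; congr pair; ring.
  + apply: Or32; suff [-> ->] : c = c'.+1 /\ b = b' by [].
    apply: grid_point_inj; rewrite pE.
    by move: qE => [<- <-]; rewrite /grid_point -natr1; congr pair; ring.
  + apply: Or33; apply: grid_point_inj; rewrite qE.
    move: pE => [<- <-]; rewrite /grid_point -natr1 natrD mulrDl kV.
    by congr pair; ring.
- have -> : grid_point c b.+1 =
    (c%:R - b%:R / k%:R - k%:R^-1, b%:R / k%:R + k%:R^-1).
    by rewrite /grid_point -natr1; congr pair; ring.
  exact: Diagonal.
- have -> : grid_point c'.+1 b = (c'%:R - b%:R / k%:R + 1, b%:R / k%:R).
    by rewrite /grid_point -natr1; congr pair; ring.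
  exact: Horizontal.
- have -> : grid_point c.+1 (b + k) = (c%:R - b%:R / k%:R, b%:R / k%:R + 1).
    by rewrite /grid_point -natr1 natrD mulrDl kV; congr pair; ring.
  exact: Vertical.
Qed.

(* [t c] is the largest scaled height of a point of the ideal on the line
   [x + y = c], or [k * height L c] if there is none. *)
Definition admissible (t : nat -> nat) : Prop :=
  (forall c, (c <= n)%N -> (k * height L c <= t c <= k * height U c)%N) /\
  (forall c, (c < n)%N -> (t c <= t c.+1 <= t c + k)%N).

Definition points_below (t : nat -> nat) : set (R * R) :=
  [set p | exists c b, [/\ (c <= n)%N, (k * height L c < b <= t c)%N
                         & p = grid_point c b]].

Lemma points_belowE (t : nat -> nat) (c b : nat) : (c <= n)%N ->
  points_below t (grid_point c b) <-> (k * height L c < b <= t c)%N.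
Proof.
move=> cn; split=> [[c' [b' [_ h /grid_point_inj[-> ->]]]] //|h].
by exists c, b.
Qed.

Lemma points_below_ideal (t : nat -> nat) :
  admissible t -> order_ideal k U L (points_below t).
Proof.
move=> [tb ts]; split=> [p [c [b [cn hb ->]]]|p q _].
  by rewrite grid_point_poset //; move: (tb c cn); lia.
move=> /[swap]; elim=> {p q} [p q []|//|p q r _ IH1 _ IH2 /IH2/IH1 //].
move=> /[dup] /lpm_posetE[c [b [cn ->]]]; rewrite (grid_point_poset _ _ cn) => hp.
move=> /lpm_posetE[c' [b' [cn' ->]]] /lpm_basic_rel_grid hr.
rewrite !points_belowE // => hq.
(* The diagonal relation stays on one line; the horizontal one uses [t c' <= t c'.+1], the vertical
   one [t c.+1 <= t c + k]. *)
case: hr hq => -[e1 e2]; subst.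
- lia.
- move: (ts c' cn); lia.
- move: (ts c cn'); lia.
Qed.

(** The diagonal relations make [I] an initial segment of each line, with threshold [t c]. Applying
    the horizontal and vertical relations to the topmost points gives the two step inequalities. *)
Lemma order_ideal_admissible (I : set (R * R)) : order_ideal k U L I ->
  exists2 t, admissible t & I = points_below t.
Proof.
move=> [Isub Idown].
have step c b c' b' : (c <= n)%N -> (k * height L c < b <= k * height U c)%N ->
    [\/ c' = c /\ b' = b.+1, c = c'.+1 /\ b' = b | c' = c.+1 /\ b' = (b + k)%N] ->
    I (grid_point c' b') -> I (grid_point c b).
  move=> cn hb hr hI; have hp := (grid_point_poset _ _ cn).2 hb.
  apply: (Idown _ _ hp hI); apply: rt_step; split=> //; first exact: Isub.
  exact/lpm_basic_rel_grid.
have Ibound c b : (c <= n)%N -> I (grid_point c b) ->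
    (k * height L c < b <= k * height U c)%N.
  by move=> cn /Isub; rewrite grid_point_poset.
(* The range condition sits under the existential so that [choice] yields a total function; beyond
   [n] the value is arbitrary. *)
have top c : exists tc, (c <= n)%N -> (k * height L c <= tc <= k * height U c)%N /\
    forall b, I (grid_point c b) <-> (k * height L c < b <= tc)%N.
  have [cn|] := boolP (c <= n)%N; last by exists 0%N.
  have hLU : (k * height L c <= k * height U c)%N by rewrite leq_mul2l LU ?orbT.
  have [|tc htc tP] := @down_closed_interval (fun b => I (grid_point c b)) _ _ hLU.
    move=> b hb hI; apply: (step _ _ c b.+1) => //; last by apply: Or31.
    by move: (Ibound _ _ cn hI); lia.
  exists tc => _; split=> // b; split=> [/[dup] /(Ibound _ _ cn) hb|hb].
    by rewrite tP //; lia.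
  by rewrite tP //; lia.
have {top} [t tP] := choice top.
exists t; last first.
  apply/seteqP; split=> p.
    move=> /[dup] /Isub /lpm_posetE[c [b [cn ->]]] hI.
    by rewrite points_belowE // -(tP c cn).2.
  by move=> [c [b [cn hb ->]]]; rewrite (tP c cn).2.
split=> c cn; first exact: (tP c cn).1.
have [bc Ic] := tP c (ltnW cn); have [bc' Ic'] := tP c.+1 cn.
have := heightS_bounds k L c; have := heightS_bounds k U c => hU hL.
apply/andP; split.
  (* In the first case the lower bound on [t c.+1] suffices. Otherwise [(c.+1, t c)] belongs to the
     poset and lies below [(c, t c)], hence is in [I]. *)
  have [h|h] := leqP (t c) (k * height L c.+1); first lia.
  suff : I (grid_point c.+1 (t c)) by rewrite Ic'; lia.
  apply: (step _ _ c (t c)) => //; first lia; first by apply: Or32.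
  by apply/Ic; lia.
(* Likewise with [(c, t c.+1 - k)], which lies below [(c.+1, t c.+1)] by the vertical relation. *)
have [h|h] := leqP (t c.+1) (k * height L c + k); first lia.
suff : I (grid_point c (t c.+1 - k)) by rewrite Ic; lia.
apply: (step _ _ c.+1 (t c.+1)); [exact: ltnW|lia|apply: Or33; lia|].
by apply/Ic'; lia.
Qed.

Lemma card_points_below (t : nat -> nat) (c : nat) : admissible t -> (c <= n)%N ->
  #|` fset_set (points_below t `&` lpm_chain k U L c)|%fset =
    (t c - k * height L c)%N.
Proof.
move=> tadm cn.
have [tsub _] := points_below_ideal _ tadm.
set s := map (grid_point c) (iota (k * height L c).+1 (t c - k * height L c)).
(* Writing the slice as an explicit finite set also settles its finiteness, without which [fset_set]
   would return the empty set. *)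
have -> : points_below t `&` lpm_chain k U L c = [set` seq_fset tt s].
  apply/seteqP; split=> p.
    move=> [/[dup] /tsub /lpm_posetE[c' [b [cn' ->]]] + [_]].
    rewrite grid_point_sum points_belowE // => hb /eqP; rewrite eqr_nat => /eqP e.
    suff : grid_point c' b \in seq_fset tt s by [].
    by subst c'; rewrite seq_fsetE map_f // mem_iota; lia.
  move=> hp; have : p \in seq_fset tt s by exact: hp.
  rewrite seq_fsetE => /mapP[b + ->]; rewrite mem_iota => hb.
  have h : points_below t (grid_point c b) by apply/points_belowE => //; lia.
  by split=> //; split; [apply: tsub | apply: grid_point_sum].
rewrite set_fsetK size_seq_fset undup_id ?size_map ?size_iota //.
by rewrite map_inj_uniq ?iota_uniq // => b b' /grid_point_inj[].
Qed.

End GridPoset.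

(** * Both sides of the equality parametrised by admissible functions *)

Lemma ideal_vectorsE (R : realType) (m r k : nat) (U L : (r + m).-tuple bool)
    (v : 'rV[R]_(r + m).-1) :
  (0 < k)%N -> height L (r + m) = height U (r + m) ->
  (forall i, (i <= r + m)%N -> (height L i <= height U i)%N) ->
  ideal_vectors R k U L v <->
  exists2 t, admissible k (r + m) U L t &
    forall i, v 0 i = (t i.+1 - k * height L i.+1)%:R.
Proof.
move=> k0 same LU.
have lt_i (i : 'I_(r + m).-1) : (i.+1 <= r + m)%N by have := ltn_ord i; lia.
have vecE t : admissible k (r + m) U L t ->
    forall i, ideal_vector k U L (points_below R k (r + m) L t) 0 i =
              (t i.+1 - k * height L i.+1)%:R.
  move=> tadm i; rewrite mxE.
  by rewrite (card_points_below _ _ _ _ _ k0 (size_tuple U) (size_tuple L)).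
split=> [[I hI <-]|[t tadm vE]].
  have [t tadm ->] :=
    order_ideal_admissible _ _ _ _ _ k0 (size_tuple U) (size_tuple L) same LU _ hI.
  by exists t => //; apply: vecE.
exists (points_below R k (r + m) L t).
  exact: (points_below_ideal _ _ _ _ _ k0 (size_tuple U) (size_tuple L) same LU).
by apply/rowP => i; rewrite vE vecE.
Qed.

Lemma dilation_integerE (R : realType) (m r k : nat) (U L : (r + m).-tuple bool)
    (v : 'rV[R]_(r + m).-1) :
  (0 < k)%N -> height L (r + m) = height U (r + m) ->
  (forall i, (i <= r + m)%N -> (height L i <= height U i)%N) ->
  (dilation k (lpm_polytope R U L) `&` integer_points R (r + m).-1) v <->
  exists2 t, admissible k (r + m) U L t &
    forall i, v 0 i = (t i.+1 - k * height L i.+1)%:R.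
Proof.
move=> k0 same LU.
have kR0 : 0 < k%:R :> R by rewrite ltr0n.
have lt_i (i : 'I_(r + m).-1) : (i.+1 <= r + m)%N by have := ltn_ord i; lia.
have sumE i : \sum_(0 <= j < i) ((nth false U j)%:R - (nth false L j)%:R) =
    (height U i)%:R - (height L i)%:R :> R by rewrite sumrB !height_sum.
split=> [[[q [qstep qbound] <-] vint]|[t [tb ts] vE]].
  have natv i : exists a : nat, (k%:R *: q) 0 i = a%:R.
    apply/natrP; rewrite natrEint vint mxE mulr_ge0 ?ler0n //.
    by have /andP[] := qbound i.
  have [a aE] := choice natv.
  have qE i : (a i)%:R = k%:R * q 0 i by rewrite -aE mxE.
  have abound i : (a i + k * height L i.+1 <= k * height U i.+1)%N.
    have /andP[_] := qbound i; rewrite sumE -(ler_pM2l kR0) -qE mulrBr lerBrDr.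
    by rewrite -!natrM -natrD ler_nat.
  (* If step [j] of [L] is horizontal, [a j - a i] lies in [0, k] and the height is unchanged; if
     vertical, [a i - a j] lies in [0, k] and the scaled height grows by [k]. Either way the sum
     grows by an amount in [0, k]. *)
  have astep (i j : 'I_(r + m).-1) : j = i.+1 :> nat ->
      (k * height L j + a i <= k * height L j.+1 + a j <=
       k * height L j + a i + k)%N.
    move=> ij; have := qstep i j ij; rewrite heightS.
    rewrite -(pmulr_rge0 _ kR0) -[X in _ && X](ler_pM2l kR0) mulr1.
    case: (nth false L j); rewrite ?expr1 ?expr0 /= => /andP[h1 h2];
    by rewrite -!(ler_nat R) !natrD !natrM !natrD !qE; apply/andP; split; lra.
  (* The sum has at most one term: it extends [a] by 0 to the ends [c = 0] and [c = r + m], which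
     carry no coordinate. *)
  pose t c := (k * height L c + \sum_(i < (r + m).-1 | i.+1 == c) a i)%N.
  have tE (i : 'I_(r + m).-1) : t i.+1 = (k * height L i.+1 + a i)%N.
    by rewrite /t (big_pred1 i) // => j; rewrite eqSS.
  have tb c : (c <= r + m)%N -> (k * height L c <= t c <= k * height U c)%N.
    move=> cn; rewrite leq_addr /=; case: (ltnP c.-1 (r + m).-1) => hc; last first.
      rewrite /t big1 ?addn0 ?leq_mul2l ?LU ?orbT // => i /eqP e.
      by have := ltn_ord i; lia.
    case: c cn hc => [|c] cn /= hc.
      by rewrite /t big1 // ?addn0 ?leq_mul2l ?LU ?orbT.
    by rewrite (tE (Ordinal hc)) addnC abound.
  exists t; last by move=> i; rewrite aE tE addKn.
  split=> // c cn.
  have /andP[hL1 hL2] := heightS_bounds k L c.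
  have /andP[hU1 hU2] := heightS_bounds k U c.
  have /andP[] := tb c (ltnW cn); have /andP[] := tb c.+1 cn.
  (* The polytope has no step inequality for the first and last steps; there it follows from the
     bounds [tb], since the two paths share their end points. *)
  case: c cn hL1 hL2 hU1 hU2 => [|c] cn hL1 hL2 hU1 hU2.
    have h0 s : height s 0 = 0%N by rewrite /height take0.
    by move: hL1 hU2; rewrite !h0; lia.
  have [e|hc] := eqVneq c.+2 (r + m)%N.
    have same' : height L c.+2 = height U c.+2 by rewrite e.
    by move: hL1 hL2; rewrite same'; lia.
  have h1 : (c < (r + m).-1)%N by lia.
  have h2 : (c.+1 < (r + m).-1)%N by lia.
  have := astep (Ordinal h1) (Ordinal h2) erefl.
  by rewrite (tE (Ordinal h1)) (tE (Ordinal h2)) /=; lia.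
split; last by move=> i; rewrite vE natr_int.
(* The truncated subtraction is exact by the lower bound in [tb]. *)
have vB i : v 0 i = (t i.+1)%:R - k%:R * (height L i.+1)%:R.
  by rewrite vE natrB ?natrM //; have /andP[] := tb _ (lt_i i).
exists (k%:R^-1 *: v); last by rewrite scalerA mulfV ?scale1r // gt_eqF.
have bnd (x : R) : (0 <= k%:R^-1 * x <= 1) = (0 <= x <= k%:R).
  by rewrite pmulr_rge0 ?invr_gt0 // mulrC ler_pdivrMr // mul1r.
split=> [i j ij|i].
  rewrite !mxE -mulrBr mulrCA bnd !vB -ij (heightS L j).
  have : (j < r + m)%N by have := ltn_ord j; lia.
  move=> /ts /andP[]; rewrite -!(ler_nat R) !natrD => h1 h2.
  by case: (nth false L j); rewrite ?expr1 ?expr0 /=; apply/andP; split; lra.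
rewrite sumE !mxE vB; have /andP[] := tb _ (lt_i i).
rewrite -!(ler_nat R) !natrM => h1 h2.
rewrite -(ler_pM2l kR0 _ (_ - _)) mulrA mulfV ?gt_eqF // mul1r.
by rewrite pmulr_rge0 ?invr_gt0 //; apply/andP; split; lra.
Qed.

Theorem theorem4p6 (R : realType) (m r k : nat) (U L : (r + m).-tuple bool)
    (hU : lattice_path m r U) (hL : lattice_path m r L)
    (hLU : never_above L U) (hM : lpm_connected U L) (hk : (0 < k)%N) :
  ideal_vectors R k U L =
    dilation k (lpm_polytope R U L) `&` integer_points R (r + m).-1.
Proof.
have hend (P : (r + m).-tuple bool) : lattice_path m r P -> height P (r + m) = r.
  by move=> /andP[_ /eqP]; rewrite /height take_oversize ?size_tuple.
have same : height L (r + m) = height U (r + m) by rewrite !hend.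
have LU i : (i <= r + m)%N -> (height L i <= height U i)%N.
  by move=> ir; have /forallP/(_ (Ordinal (n := (r + m).+1) ir)) := hLU.
apply/seteqP; split=> v.
  by move=> /(ideal_vectorsE _ _ _ _ _ _ _ hk same LU) /dilation_integerE; apply.
by move=> /(dilation_integerE _ _ _ _ _ _ _ hk same LU) /ideal_vectorsE; apply.
Qed.
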